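(* Let $\Lambda_0<0$ and consider two branches of solutions $\Phi_{1}(\Lambda),\Phi_2(\Lambda)\in H^2_\Gamma$, $\Lambda\in(-\infty,\Lambda_0)$, of $-\Delta\Phi-2|\Phi|^2\Phi=\Lambda\Phi$, for which the maps $\Lambda\mapsto\mathcal{Q}_{j}(\Lambda):=\mathcal{Q}(\Phi_j(\Lambda))$ and $\Lambda\mapsto\mathcal{E}_{j}(\Lambda):=\mathcal{E}(\Phi_j(\Lambda))$, $j=1,2$, are $C^1$ on $(-\infty,\Lambda_0)$ and satisfy $$\frac{d\mathcal{E}_j}{d\Lambda}=\Lambda\,\frac{d\mathcal{Q}_j}{d\Lambda},\qquad j=1,2.$$ Assume that $$\lim_{\Lambda\to-\infty}|\Lambda|\,\left|\mathcal{Q}_2(\Lambda)-\mathcal{Q}_1(\Lambda)\right|=0\quad\text{and}\quad \lim_{\Lambda\to-\infty}\left|\mathcal{E}_2(\Lambda)-\mathcal{E}_1(\Lambda)\right|=0.$$ If $\mathcal{Q}_1(\Lambda)<\mathcal{Q}_2(\Lambda)$ for every $\Lambda\in(-\infty,\Lambda_0)$, then $\mathcal{E}_1(\Lambda)>\mathcal{E}_2(\Lambda)$ for every $\Lambda\in(-\infty,\Lambda_0)$. If, additionally, $\mathcal{Q}_1$ and $\mathcal{Q}_2$ are decreasing on $(-\infty,\Lambda_0)$ and the values $\Lambda_1,\Lambda_2\in(-\infty,\Lambda_0)$ are such that $\mathcal{Q}_2(\Lambda_2)=\mathcal{Q}_1(\Lambda_1)=q$, then $\mathcal{E}_1(\L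ambda_1)>\mathcal{E}_2(\Lambda_2)$.
   Context: $\Gamma$ is a metric graph with finitely many vertices and edges (finite intervals or half-lines); $\Delta$ is the second derivative on each edge; $H^2_\Gamma$ is the space of functions that are $H^2$ on each edge and satisfy Neumann--Kirchhoff conditions (continuity and vanishing sum of outgoing derivatives) at all vertices. Mass and energy: $$\mathcal{Q}(U)=\int_\Gamma |U|^2dx,\qquad \mathcal{E}(U)=\int_\Gamma\left(|\partial_xU|^2-|U|^4\right)dx.$$ The relation $d\mathcal{E}_j/d\Lambda=\Lambda\, d\mathcal{Q}_j/d\Lambda$ reflects that $\Phi_j(\Lambda)$ is a critical point of $\mathcal{E}(U)-\Lambda\mathcal{Q}(U)$. *)

(* Defs.v *)
From HB Require Import structures.
From mathcomp Require Import all_boot all_order all_algebra.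
From mathcomp Require Import complex.
From mathcomp Require Import all_classical all_reals all_analysis.

Set Implicit Arguments.
Unset Strict Implicit.
Unset Printing Implicit Defensive.

Import Order.TTheory GRing.Theory Num.Theory.
Import numFieldNormedType.Exports.

Local Open Scope ring_scope.
Local Open Scope complex_scope.
Local Open Scope classical_set_scope.

(* Loops and parallel edges are allowed. *)
Variant edge_shape (R : realType) (V : Type) :=
  | Segment of {posnum R} & V & V  (* length, vertex at 0, vertex at the end *)
  | HalfLine of V.                 (* vertex at 0 *)

Record metric_graph (R : realType) := MetricGraph {
  vertex : finType;
  edge : finType;
  shape : edge -> edge_shape R vertex }.

Local Notation Re := (@complex.Re _).
Local Notation Im := (@complex.Im _).
Local Notation normc := Normc.normc.

Section MetricGraph.
Context {R : realType}.
Implicit Types (I : set R) (f g u v w : R -> R[i]).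

Local Notation mu := (@lebesgue_measure R).

Definition cintegral I f : R[i] :=
  (\int[mu]_(x in I) Re (f x)) +i* (\int[mu]_(x in I) Im (f x)).

Definition cderiv f (x : R) : R[i] :=
  (Re \o f)^`() x +i* (Im \o f)^`() x.

(* One-sided: for s = -1 this is minus the left derivative. *)
Definition cderiv_side f (x s : R) : R[i] :=
  let q (h : R) := (h^-1)%:C * (f (x + s * h) - f x) in
  lim (Re (q h) @[h --> 0^'+]) +i* lim (Im (q h) @[h --> 0^'+]).

Definition continuous_on I f : Prop :=
  {within I, continuous (Re \o f)} /\ {within I, continuous (Im \o f)}.

Definition in_L2 I f : Prop :=
  (Re \o f) \_ I \in Lfun mu 2%:E /\ (Im \o f) \_ I \in Lfun mu 2%:E.

Definition test_function I (phi : R -> R) : Prop :=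
  (forall (n : nat) x, derivable phi^`(n) x 1) /\
  (exists a b : R, `[a, b] `<=` I° /\ (forall x, ~ `[a, b] x -> phi x = 0)).

Definition weak_derivative I u v : Prop :=
  forall phi, test_function I phi ->
    cintegral I (fun x => u x * (phi^`()%classic x)%:C) =
    - cintegral I (fun x => v x * (phi x)%:C).

(* [u] belongs to H^2(I), with weak derivatives u' = v and u'' = w. Elements
   of H^2(I) are represented by their continuous representative; it is C^1 up
   to the boundary, so [cderiv] in the interior of [I] and [cderiv_side] at its
   endpoints are genuine derivatives. *)
Definition H2_with I u v w : Prop :=
  [/\ continuous_on I u, in_L2 I u /\ in_L2 I v /\ in_L2 I w,
      weak_derivative I u v & weak_derivative I v w].

Definition H2 I u : Prop := exists v w, H2_with I u v w.

Variable G : metric_graph R.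

(* [U e] is only meaningful on [edge_dom e]. *)
Definition graph_fun := edge G -> R -> R[i].

Definition edge_dom (e : edge G) : set R :=
  match shape e with
  | Segment l _ _ => `[0, l%:num]
  | HalfLine _ => `[0, +oo[
  end.

(* The ends of an edge: vertex, coordinate of the end, and direction pointing
   away from the vertex into the edge. *)
Definition edge_ends (e : edge G) : seq (vertex G * (R * R)) :=
  match shape e with
  | Segment l a b => [:: (a, (0, 1)); (b, (l%:num, -1))]
  | HalfLine a => [:: (a, (0, 1))]
  end.

Definition vertex_continuous (U : graph_fun) : Prop :=
  forall (e e' : edge G) p p', p \in edge_ends e -> p' \in edge_ends e' ->
    p.1 = p'.1 -> U e p.2.1 = U e' p'.2.1.

Definition kirchhoff (U : graph_fun) : Prop :=
  forall a : vertex G,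
    \sum_(e : edge G) \sum_(p <- edge_ends e | p.1 == a)
      cderiv_side (U e) p.2.1 p.2.2 = 0.

Definition H2_graph (U : graph_fun) : Prop :=
  [/\ forall e, H2 (edge_dom e) (U e), vertex_continuous U & kirchhoff U].

Definition mass (U : graph_fun) : R :=
  \sum_(e : edge G) \int[mu]_(x in edge_dom e) (normc (U e x) ^+ 2).

Definition energy (U : graph_fun) : R :=
  \sum_(e : edge G) \int[mu]_(x in edge_dom e)
    (normc (cderiv (U e) x) ^+ 2 - normc (U e x) ^+ 4).

(* - Laplacian U - 2 |U|^2 U = L U, as an identity in L^2 of each edge. *)
Definition stationary_NLS (L : R) (U : graph_fun) : Prop :=
  forall e : edge G, exists v w,
    H2_with (edge_dom e) (U e) v w /\
    {ae mu, forall x, edge_dom e x ->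
      - w x - (2 * normc (U e x) ^+ 2)%:C * U e x = L%:C * U e x}.

End MetricGraph.

Definition C1_below {R : realType} (L0 : R) (f : R -> R) : Prop :=
  forall L, L < L0 -> derivable f L 1 /\ {for L, continuous f^`()}.

Definition decreasing_below {R : realType} (L0 : R) (f : R -> R) : Prop :=
  forall L L', L < L' -> L' < L0 -> f L' < f L.

(* Main.v *)
(* The action [S = E - L Q] satisfies [dS/dL = - Q], so [S2 - S1] is strictly
   decreasing; as it vanishes at [-oo], [S2 < S1]. Hence [E2 - E1 < L (Q2 - Q1) < 0].
   At equal masses the monotonicity forces [L1 < L2], and for [L > L1] the
   derivative [(L - L1) Q2'] of [E2 - L1 Q2] is nonpositive, whence
   [E2 L2 - L1 q <= E2 L1 - L1 (Q2 L1) < E1 L1 - L1 q]. *)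
Require Import Defs.
From mathcomp Require Import all_boot all_order all_algebra.
From mathcomp Require Import all_classical all_reals all_analysis.
From mathcomp Require Import lra.

Import Order.TTheory GRing.Theory Num.Theory.
Import numFieldNormedType.Exports.

Local Open Scope ring_scope.
Local Open Scope classical_set_scope.

Lemma MVT_below (R : realType) (f df : R -> R) (L0 a b : R) :
  (forall x, x < L0 -> is_derive x 1 f (df x)) -> a < b -> b < L0 ->
  exists2 c, a < c < b & f b - f a = df c * (b - a).
Proof.
move=> fdf ab bL0; have [x||c cab fab] := @MVT R f df a b ab.
- by rewrite in_itv => /andP[_ xb]; apply/fdf/(lt_trans xb).
- apply: derivable_within_continuous => x; rewrite in_itv => /andP[_ xb].
  by have [] := fdf _ (le_lt_trans xb bL0).
- by exists c => //; rewrite in_itv in cab.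
Qed.

(** With the multiplier [M] frozen, [E' - M Q'] becomes [(L - M) Q'] on substituting [E' = L Q'];
    its sign is then read off from those of [L - M] and [Q']. *)
Lemma is_derive_lagrangian (R : realType) (Q E : R -> R) (M L : R) :
  derivable Q L 1 -> derivable E L 1 -> E^`()%classic L = L * Q^`()%classic L ->
  is_derive L 1 (fun x => E x - M * Q x) ((L - M) * Q^`()%classic L).
Proof.
move=> /derivableP dQ /derivableP dE; rewrite !derive1E => EQ.
apply: is_derive_eq; rewrite EQ /GRing.scale /=; lra.
Qed.

(** The product rule gives [E' - Q - L Q'], and the terms [E'] and [L Q'] cancel. *)
Lemma is_derive_action (R : realType) (Q E : R -> R) (L : R) :
  derivable Q L 1 -> derivable E L 1 -> E^`()%classic L = L * Q^`()%classic L ->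
  is_derive L 1 (fun x => E x - x * Q x) (- Q L).
Proof.
move=> /derivableP dQ /derivableP dE; rewrite !derive1E => EQ.
apply: is_derive_eq; rewrite EQ /GRing.scale /=; lra.
Qed.

Lemma derive1_decreasing_below (R : realType) (L0 : R) (Q : R -> R) (L : R) :
  C1_below L0 Q -> decreasing_below L0 Q -> L < L0 -> Q^`()%classic L <= 0.
Proof.
move=> CQ decQ LL0; apply: (@decr_derive1_le0_itvNy R Q true L0).
- by move=> x; rewrite inE /= in_itv /= => /CQ[].
- by move=> x y xL0 yL0 /decQ; apply; rewrite in_itv in xL0.
- by rewrite in_itv.
Qed.

(** A limit preserves only weak inequalities, so strictness comes from an intermediate point:
    [F L < F (L - 1)], and [F (L - 1) <= 0] because [F x] exceeds [F (L - 1)] for all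
    [x < L - 1]. *)
Lemma decreasing_below_cvg0_lt0 (R : realType) (L0 : R) (F : R -> R) :
  decreasing_below L0 F -> F L @[L --> -oo] --> 0 ->
  forall L, L < L0 -> F L < 0.
Proof.
move=> decF F0 L LL0; have L1L : L - 1 < L by lra.
apply: (lt_le_trans (decF _ _ L1L LL0)).
apply: (cvgr_to_ge F0); near=> x.
apply/ltW/decF; last by lra.
by near: x; apply: nbhs_ninfty_lt; exact: num_real.
Unshelve. all: by end_near. Qed.

Lemma action_lt (R : realType) (L0 : R) (Q1 Q2 E1 E2 : R -> R) :
  C1_below L0 Q1 -> C1_below L0 Q2 -> C1_below L0 E1 -> C1_below L0 E2 ->
  (forall L, L < L0 -> E1^`()%classic L = L * Q1^`()%classic L) ->
  (forall L, L < L0 -> E2^`()%classic L = L * Q2^`()%classic L) ->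
  `|L| * `|Q2 L - Q1 L| @[L --> -oo] --> 0 ->
  `|E2 L - E1 L| @[L --> -oo] --> 0 ->
  (forall L, L < L0 -> Q1 L < Q2 L) ->
  forall L, L < L0 -> E2 L - L * Q2 L < E1 L - L * Q1 L.
Proof.
move=> CQ1 CQ2 CE1 CE2 EQ1 EQ2 Q0 E0 Q12 L LL0; rewrite -subr_lt0.
pose F x := (E2 x - x * Q2 x) - (E1 x - x * Q1 x).
apply: (@decreasing_below_cvg0_lt0 R L0 F) LL0 => [x y xy yL0|].
(* The derivative is [Q1 - Q2], negative by the ordering of the masses. *)
- have dF z : z < L0 -> is_derive z 1 F (- Q2 z - - Q1 z).
    move=> zL0; have [[dQ1 _] [dQ2 _]] := (CQ1 z zL0, CQ2 z zL0).
    have [[dE1 _] [dE2 _]] := (CE1 z zL0, CE2 z zL0).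
    apply: is_deriveB; first exact: is_derive_action dQ2 dE2 (EQ2 _ zL0).
    exact: is_derive_action dQ1 dE1 (EQ1 _ zL0).
  have [c /andP[_ cy] Fxy] := MVT_below _ _ _ _ _ _ dF xy yL0.
  rewrite -subr_lt0 Fxy nmulr_rlt0 ?subr_gt0 //.
  have := Q12 c (lt_trans cy yL0); lra.
- have {}E0 : E2 x - E1 x @[x --> -oo] --> 0 by apply/norm_cvg0P.
  have {}Q0 : x * (Q2 x - Q1 x) @[x --> -oo] --> 0.
    by apply/norm_cvg0P; under eq_fun do rewrite normrM.
  (* Regrouped so that each of the two terms tends to 0 by one of the asymptotic hypotheses. *)
  rewrite (_ : F = fun x => (E2 x - E1 x) - x * (Q2 x - Q1 x)); last first.
    by apply/funext => x; rewrite /F; lra.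
  by rewrite -[0]subr0; apply: cvgB.
Qed.

Theorem lemma4p2 (R : realType) (G : metric_graph R) (L0 : R)
    (Phi1 Phi2 : R -> graph_fun G) :
  let Q1 := fun L => mass (Phi1 L) in
  let Q2 := fun L => mass (Phi2 L) in
  let E1 := fun L => energy (Phi1 L) in
  let E2 := fun L => energy (Phi2 L) in
  L0 < 0 ->
  (forall L, L < L0 -> H2_graph (Phi1 L) /\ H2_graph (Phi2 L)) ->
  (forall L, L < L0 ->
     stationary_NLS L (Phi1 L) /\ stationary_NLS L (Phi2 L)) ->
  C1_below L0 Q1 -> C1_below L0 Q2 ->
  C1_below L0 E1 -> C1_below L0 E2 ->
  (forall L, L < L0 -> E1^`()%classic L = L * Q1^`()%classic L) ->
  (forall L, L < L0 -> E2^`()%classic L = L * Q2^`()%classic L) ->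
  `|L| * `|Q2 L - Q1 L| @[L --> -oo] --> 0 ->
  `|E2 L - E1 L| @[L --> -oo] --> 0 ->
  (forall L, L < L0 -> Q1 L < Q2 L) ->
  (forall L, L < L0 -> E2 L < E1 L) /\
  (decreasing_below L0 Q1 -> decreasing_below L0 Q2 ->
   forall L1 L2 q : R, L1 < L0 -> L2 < L0 -> Q2 L2 = q -> Q1 L1 = q ->
   E2 L2 < E1 L1).
Proof.
move=> Q1 Q2 E1 E2 L00 _ _ CQ1 CQ2 CE1 CE2 EQ1 EQ2 Q0 E0 Q12.
have S12 := action_lt _ _ _ _ _ _ CQ1 CQ2 CE1 CE2 EQ1 EQ2 Q0 E0 Q12.
split=> [L LL0|decQ1 decQ2 L1 L2 q L1L0 L2L0 Q2q Q1q].
  (* The sign of [L0] enters here: [L < L0 < 0]. *)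
  have := S12 L LL0; have : L * (Q2 L - Q1 L) < 0.
    by rewrite nmulr_rlt0 ?subr_gt0 ?Q12 // (lt_trans LL0).
  lra.
(* If [L2 < L1], then [q = Q1 L1 < Q1 L2 < Q2 L2 = q]; if [L2 = L1], the strict ordering of the
   masses fails. *)
have L12 : L1 < L2.
  rewrite ltNge; apply/negP; rewrite le_eqVlt => /predU1P[L21|L21].
    by have := Q12 L2 L2L0; rewrite Q2q L21 Q1q ltxx.
  by have := lt_trans (decQ1 _ _ L21 L1L0) (Q12 _ L2L0); rewrite Q2q Q1q ltxx.
have dE2 z : z < L0 ->
    is_derive z 1 (fun x => E2 x - L1 * Q2 x) ((z - L1) * Q2^`()%classic z).
  move=> zL0; have [[dQ2 _] [dE2 _]] := (CQ2 z zL0, CE2 z zL0).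
  exact: is_derive_lagrangian dQ2 dE2 (EQ2 _ zL0).
have [c /andP[L1c cL2] E2L] := MVT_below _ _ _ _ _ _ dE2 L12 L2L0.
have dQc := derive1_decreasing_below _ _ _ _ CQ2 decQ2 (lt_trans cL2 L2L0).
(* By the choice of [c], this product is the increment of [E2 - L1 Q2] from [L1] to [L2]. *)
have : (c - L1) * Q2^`()%classic c * (L2 - L1) <= 0.
  by rewrite mulr_le0_ge0 ?mulr_ge0_le0 // subr_ge0 ltW.
rewrite -E2L Q2q; have := S12 L1 L1L0; rewrite Q1q; lra.
Qed.
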